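(* Let $b \ge 2$ be an integer. There exists an effective real constant $A_b$, depending only on $b$, such that for every $\gamma \in \mathbb{R}$ and every integer $N \ge 2$, $$\min_{1 \leq n \leq N,\ n \in \mathfrak{D}_{b}} \|\gamma n\| \leq \frac{A_{b}}{\log N}.$$
   Context: For $x \in \mathbb{R}$, $\|x\|$ denotes the distance from $x$ to the nearest integer. For an integer $b \ge 2$, $$\mathfrak{D}_{b} := \left\{\sum_{d=0}^{\infty}a_{d}b^{d}: a_{d}\in \{0,1\},\ 0<\sum_{d=0}^{\infty}a_{d}<\infty\right\},$$ i.e. the set of positive integers whose base-$b$ digits all lie in $\{0,1\}$. ''Effective'' means that the constant can in principle be computed explicitly from $b$. $\log$ is the natural logarithm. *)

(* Defs.v *)
From mathcomp Require Import all_boot all_order all_algebra.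
From mathcomp Require Import all_classical all_reals all_analysis.

Set Implicit Arguments.
Unset Strict Implicit.
Unset Printing Implicit Defensive.

Import Order.TTheory GRing.Theory Num.Theory.

Local Open Scope classical_set_scope.

(* A sequence of digits in {0, 1} has a finite sum iff it vanishes from some
   index L on; both series are then the finite sums over d < L. *)
Definition digits01 (b : nat) : set nat := [set n | exists a : nat -> nat,
  (forall d, a d = 0 \/ a d = 1) /\
  exists L, [/\ forall d, L <= d -> a d = 0,
                0 < \sum_(d < L) a d &
                n = \sum_(d < L) a d * b ^ d]].

(* Total recursive functions, as the least class containing zero, successor
   and the projections, and closed under composition, primitive recursion and
   minimization of functions that have a zero for all parameters. *)
Inductive recursive : forall k : nat, (k.-tuple nat -> nat) -> Prop :=
| recursive_zero k : recursive (fun _ : k.-tuple nat => 0)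
| recursive_succ : recursive (fun v : 1.-tuple nat => (thead v).+1)
| recursive_proj k (i : 'I_k) : recursive (fun v : k.-tuple nat => tnth v i)
| recursive_comp k m (f : m.-tuple nat -> nat)
    (g : 'I_m -> k.-tuple nat -> nat) :
    recursive f -> (forall i, recursive (g i)) ->
    recursive (fun v : k.-tuple nat => f [tuple g i v | i < m])
| recursive_primrec k (f : k.-tuple nat -> nat) (g : k.+2.-tuple nat -> nat) :
    recursive f -> recursive g ->
    recursive (fun v : k.+1.-tuple nat =>
      nat_rect (fun _ => nat) (f [tuple of behead v])
        (fun n r => g [tuple of n :: r :: behead v]) (thead v))
| recursive_min k (f : k.+1.-tuple nat -> nat)
    (f0 : forall v : k.-tuple nat, exists n, f [tuple of n :: v] == 0) :
    recursive f -> recursive (fun v : k.-tuple nat => ex_minn (f0 v)).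

Local Open Scope ring_scope.

(* x |-> ||x||, the distance to the nearest integer *)
Definition dist_int (R : realType) (x : R) : R :=
  inf [set `|x - m%:~R| | m in [set: int]].

(* A is a computable sequence of reals: a single algorithm maps b and k to a
   dyadic rational (p - q) / 2 ^ k within 2 ^ -k of A b. *)
Definition effective (R : realType) (A : nat -> R) : Prop :=
  exists p q : 2.-tuple nat -> nat, [/\ recursive p, recursive q &
    forall b k : nat,
      `|A b - ((p [tuple b; k])%:R - (q [tuple b; k])%:R) / 2 ^+ k| <= 2 ^- k].

(* Main.v *)
Require Import Defs.
From mathcomp Require Import all_boot all_order all_algebra.
From mathcomp Require Import all_classical all_reals all_analysis.
From mathcomp Require Import lra zify.

Import Order.TTheory GRing.Theory Num.Theory.

(** Let [s j] be [gamma] times the sum of the powers [b ^ d] with [d < j]. Among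
    the [M + 1] points [s 0], ..., [s M] of the circle [R / Z], two lie within
    [1 / M] of each other, by Dirichlet's pigeonhole argument
    ([dist_int_pigeonhole]). Their difference is [gamma * n], where [n] is a sum
    of consecutive powers of [b], say those with [i <= d < j] and [j <= M]: a
    number whose base-[b] digits are a block of ones, hence an element of
    [digits01 b] ([digits01_block]) which is less than [b ^ M]
    ([sum_block_lt]).

    For [M] take the integer part [L] of [log N / log b], or [1] when [N < b].
    Then [n <= N], and [N < b ^ (L + 1) <= b ^ (2 * M)] gives
    [ln N <= 2 * M * ln b <= 2 * M * b], so that [1 / M <= 2 * b / ln N]. The
    constant [A b = 2 * b] is an integer, which makes its effectivity the
    recursiveness of [2 * b * 2 ^ k]; bounding [ln b] by [b] avoids computing
    logarithms. *)

Lemma eq_recursive {k : nat} {f g : k.-tuple nat -> nat} :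
  f =1 g -> recursive f -> recursive g.
Proof. by move=> /funext ->. Qed.

(** The substitution and reordering of variables used to bring a function into
    the argument order imposed by primitive recursion. *)
Lemma recursive_comp_proj {k m : nat} {f : m.-tuple nat -> nat}
    (h : 'I_m -> 'I_k) :
  recursive f ->
  recursive (fun v : k.-tuple nat => f [tuple tnth v (h i) | i < m]).
Proof.
move=> recf.
exact: (recursive_comp recf
          (fun i => recursive_proj (h i))).
Qed.

Lemma recursive_add :
  recursive (fun v : 2.-tuple nat => tnth v ord0 + tnth v (lift ord0 ord0)).
Proof.
(* In the recursion step the tuple is (counter, accumulator, parameter), and
   the accumulator has index 1. *)
have recS : recursive (fun v : 3.-tuple nat => (tnth v (inord 1)).+1).
  apply: (eq_recursive _ (recursive_comp_proj (fun=> inord 1) recursive_succ)).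
  by move=> v; rewrite /thead tnth_mktuple.
apply: (eq_recursive _ (recursive_primrec (recursive_proj (@ord0 0)) recS))
  => v.
rewrite /thead; elim: (tnth v ord0) => [|n IHn].
  rewrite /= tnth_behead; congr tnth.
  by apply/val_inj; rewrite /= inordK.
by rewrite /= (tnth_nth 0) inordK //= IHn.
Qed.

Lemma recursive_double :
  recursive (fun v : 1.-tuple nat => tnth v ord0 + tnth v ord0).
Proof.
apply: (eq_recursive _ (recursive_comp_proj (fun=> ord0) recursive_add)) => v.
by rewrite !tnth_mktuple.
Qed.

(** Primitive recursion on the exponent: start from the double of the first
    argument and double again at each step. Since [recursive_primrec] recurses
    on the head of the tuple, the two arguments are exchanged by [rev_ord]. *)
Lemma recursive_double_shift :
  recursive (fun v : 2.-tuple nat =>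
    (tnth v ord0 + tnth v ord0) * 2 ^ tnth v (lift ord0 ord0)).
Proof.
have recD : recursive (fun v : 3.-tuple nat =>
    tnth v (inord 1) + tnth v (inord 1)).
  apply: (eq_recursive _ (recursive_comp_proj (fun=> inord 1)
    recursive_double)).
  by move=> v; rewrite tnth_mktuple.
have recP := recursive_primrec recursive_double recD.
apply: (eq_recursive _ (recursive_comp_proj (@rev_ord 2) recP)) => v.
rewrite /thead tnth_mktuple.
have -> : rev_ord (@ord0 1) = lift ord0 ord0 by apply/val_inj.
elim: (tnth v (lift _ _)) => [|n IHn].
  rewrite /= tnth_behead tnth_mktuple muln1.
  by have -> : rev_ord (inord 1 : 'I_2) = ord0
    by apply/val_inj; rewrite /= inordK.
by rewrite /= (tnth_nth 0) inordK //= IHn expnS mulnCA addnn mul2n.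
Qed.

Local Open Scope ring_scope.

Lemma effective_double_nat (R : realType) :
  effective (fun b : nat => (b + b)%:R : R).
Proof.
exists (fun v => (tnth v ord0 + tnth v ord0) * 2 ^ tnth v (lift ord0 ord0))%N.
exists (fun=> 0%N); split.
- exact: recursive_double_shift.
- exact: recursive_zero.
move=> b k; rewrite !(tnth_nth 0%N) /= subr0 natrM natrX mulfK.
  by rewrite subrr normr0 invr_ge0 exprn_ge0.
by rewrite expf_neq0 // pnatr_eq0.
Qed.

Lemma dist_int_le {R : realType} (x : R) (m : int) :
  dist_int x <= `|x - m%:~R|.
Proof.
apply: ge_inf; last by exists m.
by exists 0 => _ [k _ <-].
Qed.

(** Cut the circle into [M] half-open arcs of length [1 / M]: two of the
    [M + 1] points [s 0], ..., [s M] fall into the same arc. *)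
Lemma dist_int_pigeonhole {R : realType} (s : nat -> R) (M : nat) :
  (0 < M)%N ->
  exists i j : nat, [/\ (i < j)%N, (j <= M)%N &
    dist_int (s j - s i) <= M%:R^-1].
Proof.
move=> M_gt0; have MR_gt0 : 0 < M%:R :> R by rewrite ltr0n.
pose frac i := s i - (Num.floor (s i))%:~R.
have frac_ge0 i : 0 <= frac i by rewrite subr_ge0 floor_le.
have frac_lt1 i : frac i < 1.
  by rewrite ltrBlDl; have := floorD1_gt (s i); rewrite intrD.
pose box i := Num.truncn (M%:R * frac i).
have box_itv i : (box i)%:R <= M%:R * frac i < (box i).+1%:R.
  by apply: truncn_itv; rewrite mulr_ge0 // ltW.
have box_lt i : (box i < M)%N.
  have /andP[le_box _] := box_itv i.
  rewrite -(ltr_nat R); apply: le_lt_trans le_box _.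
  by rewrite gtr_pMr.
pose f (i : 'I_M.+1) := Ordinal (box_lt i).
have /injectivePn[i [j neq_ij /(congr1 val) /= eq_box]] : ~~ injectiveb f.
  by apply/injectiveP => /leq_card; rewrite !card_ord ltnn.
have close (k l : nat) : box k = box l -> dist_int (s l - s k) <= M%:R^-1.
  move=> eq_kl.
  have := dist_int_le (s l - s k) (Num.floor (s l) - Num.floor (s k)).
  move=> /le_trans; apply.
  have -> : s l - s k - (Num.floor (s l) - Num.floor (s k))%:~R =
    frac l - frac k.
    by rewrite /frac rmorphB /=; lra.
  rewrite -(ler_pM2l MR_gt0) mulfV ?gt_eqF // -[X in X * _]normr_nat.
  rewrite -normrM mulrBr.
  have := box_itv k; have := box_itv l; rewrite eq_kl -natr1 ler_norml; lra.
have [lt_ij|lt_ji|eq_ij] := ltngtP i j.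
- by exists i, j; split; [|rewrite -ltnS|exact: close].
- by exists j, i; split; [|rewrite -ltnS|exact: close].
- by rewrite (val_inj eq_ij) eqxx in neq_ij.
Qed.


Lemma digits01_block {b i j : nat} : (0 < b)%N -> (i < j)%N ->
  digits01 b (\sum_(i <= d < j) b ^ d)%N.
Proof.
move=> b_gt0 lt_ij; exists (fun d => (i <= d < j)%N : nat); split.
  by move=> d; case: (i <= d < j)%N; [right|left].
exists j; split.
- by move=> d le_jd; rewrite [(d < j)%N]ltnNge le_jd andbF.
- by rewrite (bigD1 (Ordinal lt_ij)) //= leqnn lt_ij addn_gt0.
rewrite (big_nat_widenl i 0%N) //= big_mkord big_mkcond.
by apply: eq_bigr => d _; rewrite ltn_ord andbT; case: ifP; rewrite ?mul1n.
Qed.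

(** Adding the term [b ^ j] to a sum below [b ^ j] gives less than
    [2 * b ^ j <= b ^ (j + 1)]. *)
Lemma sum_block_lt {b i j : nat} : (1 < b)%N ->
  (\sum_(i <= d < j) b ^ d < b ^ j)%N.
Proof.
move=> b_gt1; have b_gt0 := ltnW b_gt1.
elim: j => [|j IHj]; first by rewrite big_geq // expn_gt0 b_gt0.
have [le_ij|lt_ji] := leqP i j; last by rewrite big_geq // expn_gt0 b_gt0.
rewrite big_nat_recr //= expnS.
have : (2 * b ^ j <= b * b ^ j)%N by rewrite leq_mul2r b_gt1 orbT.
lia.
Qed.

(** The pigeonhole argument for the partial sums of [gamma * b ^ d]: a
    difference of two partial sums is a sum over a block of exponents. *)
Lemma dist_int_block {R : realType} (b M : nat) (gamma : R) : (0 < M)%N ->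
  exists i j : nat, [/\ (i < j)%N, (j <= M)%N &
    dist_int (gamma * (\sum_(i <= d < j) b ^ d)%N%:R) <= M%:R^-1].
Proof.
move=> M_gt0.
have [i [j [lt_ij le_jM close]]] :=
  dist_int_pigeonhole (fun j => gamma * (\sum_(0 <= d < j) b ^ d)%N%:R) M M_gt0.
exists i, j; split=> //; move: close.
rewrite -mulrBr (big_cat_nat (leq0n i) (ltnW lt_ij)) /=.
by rewrite natrD addrAC subrr add0r.
Qed.

Theorem mainTheorem3 (R : realType) :
  exists A : nat -> R, effective A /\
    forall b : nat, (2 <= b)%N ->
    forall (gamma : R) (N : nat), (2 <= N)%N ->
      (\big[mine/+oo]_(1 <= n < N.+1 | n \in digits01 b)
          (dist_int (gamma * n%:R)%R)%:E
        <= (A b / ln N%:R)%R%:E)%E.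
Proof.
exists (fun b => (b + b)%:R); split; first exact: effective_double_nat.
move=> b b_gt1 gamma N N_gt1; have b_gt0 := ltnW b_gt1.
have [le_logN ltN] := andP (trunc_log_bounds b_gt1 (ltnW N_gt1)).
set L := trunc_log b N in le_logN ltN.
(* The maximum matters only when N < b; then the block found is n = 1. *)
pose M := maxn 1 L.
have M_gt0 : (0 < M)%N by rewrite leq_max.
have [i [j [lt_ij le_jM close]]] := dist_int_block b M gamma M_gt0.
have block := digits01_block b_gt0 lt_ij.
have block_le : (\sum_(i <= d < j) b ^ d <= N)%N.
  have [L0|L_gt0] := posnP L.
    have [-> ->] : i = 0%N /\ j = 1%N by rewrite /M L0 in le_jM; lia.
    by rewrite big_nat1 expn0 ltnW.
  apply: leq_trans (ltnW (sum_block_lt b_gt1)) (leq_trans _ le_logN).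
  by rewrite leq_exp2l //; rewrite /M in le_jM; lia.
have block_gt0 : (0 < \sum_(i <= d < j) b ^ d)%N.
  by rewrite big_ltn // addn_gt0 expn_gt0 b_gt0.
apply: (bigmin_inf_seq _ (\sum_(i <= d < j) b ^ d)%N).
- by rewrite mem_index_iota block_gt0 ltnS.
- exact: mem_set.
rewrite lee_fin; apply: le_trans close _.
have N_gt1R : 1 < N%:R :> R by rewrite ltr1n.
have b_gt0R : 0 < b%:R :> R by rewrite ltr0n.
have M_gt0R : 0 < M%:R :> R by rewrite ltr0n.
rewrite ler_pdivlMr ?ln_gt0 // mulrC ler_pdivrMr //.
have leN : N%:R <= b%:R ^+ (M + M) :> R.
  rewrite -natrX ler_nat; apply: leq_trans (ltnW ltN) _.
  by rewrite leq_exp2l // /M; lia.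
apply: (@le_trans _ _ (ln (b%:R ^+ (M + M)))).
  by rewrite ler_ln // posrE ?exprn_gt0 // (lt_trans ltr01).
rewrite lnXn // -[ln _ *+ _]mulr_natr !natrD.
have := ler_wpM2r (ltW M_gt0R) (ltW (ln_sublinear b_gt0R)); lra.
Qed.
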